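(* Suppose that: (A) each $f_i$ and each $h_i$ is proper, closed and convex, each $f_i$ is $L_i$-smooth for some $L_i>0$, each $f_i+h_i$ is bounded from below, and the problem $\min_{x\in\mathbb{R}^d}\sum_{i\in\mathcal V}(f_i(x)+h_i(x))$ has a non-empty optimal solution set, with (finite) optimal value $F_{\mathrm{opt}}$. Then there is a constant $C\ge 0$, depending only on the functions $f_i,h_i$ ($i\in\mathcal V$) and not on $\alpha$ or $W$, such that the following holds for every averaging matrix $W$ associated with $\mathcal G$ having the property (B) for every $\alpha>0$ the function $\mathbf{x}\mapsto F(\mathbf{x})+\frac{1}{2\alpha}\mathbf{x}^T(I-\mathbf{W})\mathbf{x}$ has a minimizer over $\mathbb{R}^{nd}$. With $\beta=\max\{|\lambda_2(W)|,|\lambda_n(W)|\}$ one has $\beta\in[0,1)$, and for every $\alpha>0$ and every fixed point $\mathbf{x}^\star=((x_1^\star)^T,\dots,(x_n^\star)^T)^T$ of Prox-DGD (with parameters $\alpha$ and $W$), $$F(\mathbf{x}^\star)\le F_{\mathrm{opt}}\qquad\text{and}\qquad \|x_i^\star-\bar x^\star\|\le C\sqrt{\frac{\alpha}{1-\beta}}\quad\forall i\in\mathcal V,$$ where $\bar x^\star=\frac1n\sum_{i\in\mathcal V}x_i^\star$.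
   Context: $\mathcal G=(\mathcal V,\mathcal E)$ is an undirected connected graph with vertex set $\mathcal V=\{1,\dots,n\}$, $n\ge 2$; $\mathcal E$ contains no self-loops. For each $i\in\mathcal V$, $f_i:\mathbb{R}^d\to\mathbb{R}$ and $h_i:\mathbb{R}^d\to\mathbb{R}\cup\{+\infty\}$. A differentiable function $f$ is $L$-smooth if $\|\nabla f(y)-\nabla f(x)\|\le L\|y-x\|$ for all $x,y$. For $\mathbf{x}=(x_1^T,\dots,x_n^T)^T\in\mathbb{R}^{nd}$ with $x_i\in\mathbb{R}^d$, put $f(\mathbf{x})=\sum_{i}f_i(x_i)$, $h(\mathbf{x})=\sum_i h_i(x_i)$, $F(\mathbf{x})=f(\mathbf{x})+h(\mathbf{x})$. A matrix $W=(w_{ij})\in\mathbb{R}^{n\times n}$ is an averaging matrix associated with $\mathcal G$ if it is symmetric and doubly stochastic (non-negative, each row and each column sums to 1), and $w_{ij}>0$ if $\{i,j\}\in\mathcal E$ or $i=j$, and $w_{ij}=0$ otherwise. $\mathbf{W}=W\otimes I_d$. $\lambda_i(W)$ denotes the $i$-th largest eigenvalue of $W$. $\operatorname{prox}_{g}(x)=\arg\min_y\, g(y)+\frac12\|y-x\|^2$. Prox-DGD with step-size $\alpha>0$ is the iteration $\mathbf{x}^{k+1}=\operatorname{prox}_{\alpha h}(\mathbf{W}\mathbf{x}^k-\alpha\nabla f(\mathbf{x}^k))$; a fixed point is $\mathbf{x}^\star$ with $\mathbf{x}^\star=\operatorname{prox}_{\alpha h}(\mathbf{W}\mathbf{x}^\star-\alpha\nabla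 f(\mathbf{x}^\star))$. *)

(* Defs.v *)
From mathcomp Require Export all_boot all_order all_algebra.
From mathcomp Require Export mathcomp_extra boolp classical_sets functions reals
  ereal topology normedtype derive.
From mathcomp Require Export mxtens.
Export Order.TTheory GRing.Theory Num.Theory.
Export numFieldNormedType.Exports.

Set Implicit Arguments.
Unset Strict Implicit.
Unset Printing Implicit Defensive.

Local Open Scope classical_set_scope.
Local Open Scope ring_scope.

(* The canonical norm on 'cV[R]_d in MathComp-Analysis is the sup norm; the
   Euclidean norm is needed here. *)
Definition enorm (R : realType) d (x : 'cV[R]_d) : R :=
  Num.sqrt (\sum_(j < d) x j 0 ^+ 2).

Definition grad (R : realType) d (f : 'cV[R]_d -> R) (x : 'cV[R]_d) : 'cV[R]_d :=
  \col_(j < d) 'D_(delta_mx j 0) f x.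

Definition smooth (R : realType) d (L : R) (f : 'cV[R]_d -> R) : Prop :=
  (forall x, differentiable f x) /\
  (forall x y, enorm (grad f y - grad f x) <= L * enorm (y - x)).

Definition proper_function (R : realType) d (g : 'cV[R]_d -> \bar R) : Prop :=
  (forall x, g x != -oo%E) /\ (exists x, g x != +oo%E).

Definition epigraph (R : realType) d (g : 'cV[R]_d -> \bar R)
    : set ('cV[R]_d * R) :=
  [set p | (g p.1 <= p.2%:E)%E].

Definition closed_function (R : realType) d (g : 'cV[R]_d -> \bar R) : Prop :=
  closed (epigraph g).

(* At t = 0 and t = 1 this uses the MathComp convention 0 * +oo = 0. *)
Definition convex_efunction (R : realType) d (g : 'cV[R]_d -> \bar R) : Prop :=
  forall (t : R) (x y : 'cV[R]_d), 0 <= t <= 1 ->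
    (g (t *: x + (1 - t) *: y)%R <= t%:E * g x + (1 - t)%:E * g y)%E.

Definition proper_closed_convex (R : realType) d (g : 'cV[R]_d -> \bar R) : Prop :=
  [/\ proper_function g, closed_function g & convex_efunction g].

Definition argmin (R : realType) (T : Type) (phi : T -> \bar R) : set T :=
  [set x | forall y, (phi x <= phi y)%E].

(* The prox is kept as the set of minimizers; it is a singleton whenever g is
   proper, closed and convex, so [prox g v y] reads y = prox_g(v). *)
Definition prox (R : realType) d (g : 'cV[R]_d -> \bar R) (v : 'cV[R]_d)
    : set 'cV[R]_d :=
  argmin (fun y => g y + (2^-1 * enorm (y - v) ^+ 2)%:E)%E.

(* A vector of R^(nd) is stacked blockwise, consistently with [tensmx]: the
   j-th coordinate of x_i sits at position i * d + j. *)
Definition block (R : realType) n d (x : 'cV[R]_(n * d)) (i : 'I_n) : 'cV[R]_d :=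
  \col_(j < d) x (mxtens_index (i, j)) 0.

Definition mean (R : realType) n d (x : 'cV[R]_(n * d)) : 'cV[R]_d :=
  n%:R^-1 *: \sum_(i < n) block x i.

Definition fsum (R : realType) n d (f : 'I_n -> 'cV[R]_d -> R)
    (x : 'cV[R]_(n * d)) : R :=
  \sum_(i < n) f i (block x i).

Definition hsum (R : realType) n d (h : 'I_n -> 'cV[R]_d -> \bar R)
    (x : 'cV[R]_(n * d)) : \bar R :=
  (\sum_(i < n) h i (block x i))%E.

Definition Fsum (R : realType) n d (f : 'I_n -> 'cV[R]_d -> R)
    (h : 'I_n -> 'cV[R]_d -> \bar R) (x : 'cV[R]_(n * d)) : \bar R :=
  ((fsum f x)%:E + hsum h x)%E.

Definition objective (R : realType) n d (f : 'I_n -> 'cV[R]_d -> R)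
    (h : 'I_n -> 'cV[R]_d -> \bar R) (x : 'cV[R]_d) : \bar R :=
  (\sum_(i < n) ((f i x)%:E + h i x))%E.

Definition Fopt (R : realType) n d (f : 'I_n -> 'cV[R]_d -> R)
    (h : 'I_n -> 'cV[R]_d -> \bar R) : \bar R :=
  ereal_inf (range (objective f h)).

Definition connected_graph n (e : rel 'I_n) : Prop :=
  [/\ symmetric e, irreflexive e & forall i j, connect e i j].

Definition averaging_matrix (R : realType) n (e : rel 'I_n) (W : 'M[R]_n) : Prop :=
  [/\ W^T = W,
      forall i j, 0 <= W i j,
      forall i, \sum_(j < n) W i j = 1,
      forall j, \sum_(i < n) W i j = 1
    & forall i j, (e i j || (i == j) -> 0 < W i j) /\
                  (~~ (e i j || (i == j)) -> W i j = 0)].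

(* The eigenvalues of W with multiplicity, in nonincreasing order. This list is
   unique when it exists, and it exists for every symmetric W; for a matrix
   whose characteristic polynomial does not split over R it is [::]. *)
Definition eigenvalues (R : realType) n (W : 'M[R]_n) : seq R :=
  xget [::] [set s : seq R | sorted >=%R s /\
                             char_poly W = \prod_(a <- s) ('X - a%:P)].

(* The k-th largest eigenvalue, 1-based. *)
Definition lambda (R : realType) n (k : nat) (W : 'M[R]_n) : R :=
  nth 0 (eigenvalues W) k.-1.

Definition beta (R : realType) n (W : 'M[R]_n) : R :=
  Num.max `|lambda 2 W| `|lambda n W|.

Definition bigW (R : realType) n d (W : 'M[R]_n) : 'M[R]_(n * d) :=
  W *t (1%:M : 'M[R]_d).

Definition penalized (R : realType) n d (f : 'I_n -> 'cV[R]_d -> R)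
    (h : 'I_n -> 'cV[R]_d -> \bar R) (W : 'M[R]_n) (alpha : R)
    (x : 'cV[R]_(n * d)) : \bar R :=
  (Fsum f h x +
   ((2 * alpha)^-1 * (x^T *m (1%:M - bigW d W) *m x) 0 0)%:E)%E.

Definition proxDGD_fixed_point (R : realType) n d (f : 'I_n -> 'cV[R]_d -> R)
    (h : 'I_n -> 'cV[R]_d -> \bar R) (W : 'M[R]_n) (alpha : R)
    (x : 'cV[R]_(n * d)) : Prop :=
  prox (fun y => alpha%:E * hsum h y)%E
       (bigW d W *m x - alpha *: grad (fsum f) x) x.

(* Main.v *)
(** Convexity of [h] turns the fixed-point equation into the variational
    inequality [h y - h x + <y - x, grad f x + (I - W) x / alpha> >= 0], and
    testing it at the consensual vector [y] built from an optimal point [z],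
    where [(I - W) y = 0], gives, with the gradient inequality for [f],
    [F x + <x, (I - W) x> / alpha <= Fopt]. Both claims follow: the energy
    [<x, (I - W) x>] dominates [(1 - beta) * sum_i |x_i - mean x|^2], and
    [F x] is bounded below by the sum [m] of the lower bounds of [f_i + h_i],
    so that [C = sqrt (Fopt - m)] works. The spectral gap comes from the
    spectral theorem over [R[i]] and the Dirichlet form
    [sum_ij w_ij (v_i - v_j)^2], which on a connected graph vanishes only on
    constant vectors. *)

Require Import Defs.
From mathcomp Require Import sesquilinear spectral complex.
From mathcomp Require Import ring lra.

Local Open Scope classical_set_scope.
Local Open Scope ring_scope.

Set Implicit Arguments.
Unset Strict Implicit.

(** * Spectral decomposition of real symmetric matrices *)

Section Spectral.
Local Open Scope sesquilinear_scope.

(** A real symmetric matrix is Hermitian, so the complex spectral theorem diagonalizes it with real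
    eigenvalues; taking [Re] of the diagonal therefore loses nothing. *)
Lemma symmetric_spectral (R : rcfType) n (A : 'M[R]_n) : A^T = A ->
  exists (U : 'M[R[i]]_n) (D : 'rV[R]_n), U \is unitarymx /\
    map_mx (real_complex R) A =
      U ^t* *m diag_mx (map_mx (real_complex R) D) *m U.
Proof.
move=> Asym; set B := map_mx (real_complex R) A.
have Breal : B \is a mxOver Num.real.
  by apply/mxOverP => i j; rewrite mxE; apply/complex_realP; exists (A i j).
have Bherm : B \is hermsymmx.
  apply: realsym_hermsym => //; apply/is_hermitianmxP.
  by rewrite expr0 scale1r map_mx_id// map_trmx Asym.
have Dreal := hermitian_spectral_diag_real Bherm.
exists (spectralmx B), (map_mx (@complex.Re R) (spectral_diag B)); split.
  exact: spectral_unitarymx.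
have /orthomx_spectralP {1}-> := hermitian_normalmx Bherm.
rewrite invmx_unitary ?spectral_unitarymx//; congr (_ *m diag_mx _ *m _).
by apply/rowP => i; rewrite !mxE RRe_real//; exact: (mxOverP Dreal).
Qed.

Lemma char_poly_conj (R : comUnitRingType) n (P Q A : 'M[R]_n) :
  P *m Q = 1%:M -> char_poly (P *m A *m Q) = char_poly A.
Proof.
move=> PQ; pose c := map_mx (@polyC R).
have cPQ : c _ _ P *m c _ _ Q = 1%:M by rewrite /c -map_mxM PQ map_mx1.
rewrite /char_poly; have -> : char_poly_mx (P *m A *m Q) =
    c _ _ P *m char_poly_mx A *m c _ _ Q.
  rewrite /char_poly_mx mulmxBr mulmxBl /c !map_mxM scalar_mxC.
  by rewrite -(mulmxA 'X%:M) -!map_mxM PQ map_mx1 mulmx1.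
by rewrite !det_mulmx mulrAC -det_mulmx cPQ det1 mul1r.
Qed.

Lemma trmxC_real (R : rcfType) m n (v : 'M[R]_(m, n)) :
  (map_mx (real_complex R) v) ^t* = (map_mx (real_complex R) v)^T.
Proof.
apply/matrixP => i j; rewrite !mxE.
by apply/CrealP/complex_realP; exists (v j i).
Qed.

Section EigenvaluesSymmetric.
Variables (R : realType) (n : nat) (A : 'M[R]_n) (U : 'M[R[i]]_n) (D : 'rV[R]_n).
Hypothesis Uu : U \is unitarymx.
Hypothesis AE : map_mx (real_complex R) A =
  U ^t* *m diag_mx (map_mx (real_complex R) D) *m U.

Lemma char_poly_spectral : char_poly A = \prod_i ('X - (D 0 i)%:P).
Proof.
apply: (map_poly_inj (real_complex R)).
rewrite map_char_poly AE char_poly_conj; last first.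
  by apply: mulmx1C; apply/unitarymxP.
rewrite char_poly_trig ?diag_mx_is_trig// rmorph_prod/=.
by apply: eq_bigr => i _; rewrite !mxE eqxx mulr1n rmorphB/= map_polyX map_polyC.
Qed.

(** The set inside [xget] is inhabited by the sorted diagonal [D], and unique factorization into
    monic linear factors makes any element of it a permutation of that diagonal. *)
Lemma eigenvalues_spectral :
  sorted >=%R (eigenvalues A) /\ perm_eq (eigenvalues A) [seq D 0 i | i : 'I_n].
Proof.
have [|srt ch] := @xgetPex _ [::] [set s : seq R | sorted >=%R s /\
                             char_poly A = \prod_(a <- s) ('X - a%:P)].
  exists (sort >=%R [seq D 0 i | i : 'I_n]); split.
    by apply: sort_sorted => x y; exact: le_total.
  rewrite (perm_big _ (permEl (perm_sort _ _))) /= big_map char_poly_spectral.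
  by rewrite big_enum.
split=> //; apply: prod_XsubC_eq; rewrite /eigenvalues -ch char_poly_spectral.
by rewrite big_map big_enum.
Qed.

Lemma row_spectral i :
  row i U *m map_mx (real_complex R) A = (D 0 i)%:C%C *: row i U.
Proof.
rewrite AE -row_mul !mulmxA (unitarymxP Uu) mul1mx.
by apply/rowP => j; rewrite [LHS]mxE mul_diag_mx !mxE.
Qed.

(** The rows of [U] form an orthonormal eigenbasis and [u] holds the coordinates of [v] in it, so
    the quadratic form becomes diagonal. *)
Lemma spectral_form (v : 'rV[R]_n) :
  let u := map_mx (real_complex R) v *m U ^t* in
  ((v *m A *m v^T) 0 0)%:C%C = \sum_i (D 0 i)%:C%C * `|u 0 i| ^+ 2.
Proof.
move=> u; set V := map_mx (real_complex R) v.
have uT : u ^t* = U *m V^T by rewrite trmx_mul map_mxM trmxCK trmxC_real.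
transitivity ((u *m diag_mx (map_mx (real_complex R) D) *m u ^t*) 0 0).
  rewrite uT /u -/V !mulmxA -(mulmxA V) -(mulmxA V) -AE map_trmx -!map_mxM.
  by rewrite [RHS]mxE.
rewrite mxE; apply: eq_bigr => i _; clearbody u.
by rewrite mul_mx_diag !mxE normCK mulrA (mulrC (u 0 i)).
Qed.

Lemma spectral_norm (v : 'rV[R]_n) :
  let u := map_mx (real_complex R) v *m U ^t* in
  ((v *m v^T) 0 0)%:C%C = \sum_i `|u 0 i| ^+ 2.
Proof.
move=> u; set V := map_mx (real_complex R) v.
have uT : u ^t* = U *m V^T by rewrite trmx_mul map_mxM trmxCK trmxC_real.
transitivity ((u *m u ^t*) 0 0); last first.
  by rewrite mxE; clearbody u; apply: eq_bigr => i _; rewrite !mxE normCK.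
rewrite uT /u -/V mulmxA mulmxKtV// map_trmx -!map_mxM.
by rewrite [RHS]mxE.
Qed.

End EigenvaluesSymmetric.

(** * Spectral gap of an averaging matrix on a connected graph *)

Section Averaging.
Variables (R : realType) (n : nat) (e : rel 'I_n) (W : 'M[R]_n).
Hypothesis We : averaging_matrix e W.

(** Once the square is expanded, row and column sums turn both pure squares into [|v|^2], and the
    cross term is the form of [W]. The case [s = -1] is the Dirichlet form; [s = 1] bounds the
    spectrum from below. *)
Lemma averaging_form (s : R) (v : 'rV[R]_n) : s ^+ 2 = 1 ->
  \sum_i \sum_j W i j * (v 0 i + s * v 0 j) ^+ 2 =
  2 * ((v *m v^T) 0 0 + s * (v *m W *m v^T) 0 0).
Proof.
case: We => _ _ row1 col1 _ s1.
have -> : (v *m v^T) 0 0 = \sum_i v 0 i ^+ 2.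
  by rewrite mxE; apply: eq_bigr => i _; rewrite !mxE expr2.
have -> : (v *m W *m v^T) 0 0 = \sum_i \sum_j W i j * (v 0 i * v 0 j).
  rewrite mxE exchange_big; apply: eq_bigr => j _ /=.
  rewrite !mxE mulr_suml; apply: eq_bigr => i _; ring.
have e1 : \sum_i v 0 i ^+ 2 = \sum_i \sum_j W i j * v 0 i ^+ 2.
  by apply: eq_bigr => i _; rewrite -mulr_suml row1 mul1r.
have e2 : \sum_i v 0 i ^+ 2 = \sum_i \sum_j W i j * v 0 j ^+ 2.
  by rewrite exchange_big; apply: eq_bigr => j _; rewrite -mulr_suml col1 mul1r.
rewrite mulrDr mulrA -[2]/(1 + 1) mulrDl !mul1r {1}e1 e2.
rewrite !mulr_sumr -!big_split /=; apply: eq_bigr => i _.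
rewrite !mulr_sumr -!big_split /=; apply: eq_bigr => j _; ring: s1.
Qed.

Lemma averaging_form_ge0 (s : R) (v : 'rV[R]_n) : s ^+ 2 = 1 ->
  0 <= (v *m v^T) 0 0 + s * (v *m W *m v^T) 0 0.
Proof.
case: (We) => _ W0 _ _ _ /averaging_form E.
rewrite -(pmulr_rge0 _ (ltr0n R 2)) -E.
by apply: sumr_ge0 => i _; apply: sumr_ge0 => j _; rewrite mulr_ge0 ?sqr_ge0.
Qed.

(* The positive diagonal is what keeps -1 out of the spectrum. *)
Lemma averaging_eigenvalue_bounds a : eigenvalue W a -> -1 < a <= 1.
Proof.
move=> /eigenvalueP[v va v0].
have vW : (v *m W *m v^T) 0 0 = a * (v *m v^T) 0 0.
  by rewrite va -scalemxAl mxE.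
have N : (v *m v^T) 0 0 = \sum_i v 0 i ^+ 2.
  by rewrite mxE; apply: eq_bigr => i _; rewrite !mxE expr2.
have [k vk] : exists k, v 0 k != 0.
  by move/rV0Pn: v0.
have Npos : 0 < (v *m v^T) 0 0.
  rewrite N (bigD1 k)//= ltr_pwDl ?exprn_even_gt0//.
  by apply: sumr_ge0 => i _; exact: sqr_ge0.
apply/andP; split; last first.
  have := @averaging_form_ge0 (-1) v; rewrite vW sqrrN expr1n => /(_ erefl).
  by nra.
have := @averaging_form 1 v; rewrite vW expr1n => /(_ erefl) E.
case: We => _ W0 _ _ /(_ k k)[]; rewrite eqxx orbT => /(_ isT) Wkk _.
suff : 0 < \sum_i \sum_j W i j * (v 0 i + 1 * v 0 j) ^+ 2 by rewrite E; nra.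
have ge0 i j : 0 <= W i j * (v 0 i + 1 * v 0 j) ^+ 2.
  by rewrite mulr_ge0 ?sqr_ge0.
rewrite (bigD1 k)//= ltr_pwDl//; last first.
  by apply: sumr_ge0 => i _; apply: sumr_ge0.
rewrite (bigD1 k)//= ltr_pwDl//; last by apply: sumr_ge0.
by rewrite mulr_gt0// exprn_even_gt0//= mul1r -mulr2n -mulr_natl mulf_neq0.
Qed.

Hypothesis conn : connected_graph e.

(** On a fixed vector the Dirichlet form is 0, so each of its nonnegative terms vanishes; positive
    weights make [v] constant along edges, and paths carry this over the graph. *)
Lemma averaging_fixed_const (v : 'rV[R]_n) :
  v *m W = v -> forall i j, v 0 i = v 0 j.
Proof.
move=> vW; case: (We) => _ W0 _ _ We'; case: conn => _ _ co.
have := @averaging_form (-1) v; rewrite vW sqrrN expr1n => /(_ erefl).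
rewrite mulN1r subrr mulr0 => E.
have ge0 i j : 0 <= W i j * (v 0 i + -1 * v 0 j) ^+ 2.
  by rewrite mulr_ge0 ?sqr_ge0.
have step i j : e i j -> v 0 i = v 0 j.
  move=> eij; have /psumr_eq0P : forall i, true ->
    0 <= \sum_j W i j * (v 0 i + -1 * v 0 j) ^+ 2.
    by move=> ? _; apply: sumr_ge0.
  move=> /(_ E i isT) /psumr_eq0P => /(_ (fun j _ => ge0 i j) j isT)/eqP.
  have [+ _] := We' i j; rewrite eij => /(_ isT) Wij.
  rewrite mulf_eq0 gt_eqF//= expf_eq0/= mulN1r subr_eq0.
  by move=> /eqP.
move=> i j; have /connectP[p] := co i j.
elim: p i => [|k p IH] i /= => [_ ->//|/andP[/step -> pk] jl].
exact: IH pk jl.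
Qed.

(** Phrased as an inclusion of row spaces because this survives extension of scalars, which lets the
    real Dirichlet argument reach the complex rows of [U]. *)
Lemma averaging_eigenspace1 :
  (eigenspace W 1 <= (const_mx 1 : 'rV[R]_n))%MS.
Proof.
apply/rV_subP => v /eigenspaceP; rewrite scale1r => vW; apply/sub_rVP.
case: (pickP 'I_n) => [i0 _|n0]; last first.
  by exists 0; apply/rowP => i; have := n0 i.
exists (v 0 i0); apply/rowP => i; rewrite !mxE mulr1.
exact: averaging_fixed_const.
Qed.

(** The eigenvalue 1 is simple, and a vector with zero sum is orthogonal to its eigenspace of
    constants, so only eigenvalues up to [lambda 2 W] enter its expansion. *)
Lemma eigenvalues_averaging : (2 <= n)%N ->
  exists s, [/\ eigenvalues W = 1 :: s, size s = n.-1,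
    forall a, a \in s -> -1 < a < 1 & forall v : 'rV[R]_n, \sum_i v 0 i = 0 ->
    (v *m W *m v^T) 0 0 <= lambda 2 W * (v *m v^T) 0 0].
Proof.
move=> n2; case: (We) => Wsym _ _ col1 _.
have [U [D [Uu WE]]] := symmetric_spectral Wsym.
have [srt pm] := eigenvalues_spectral Uu WE.
have ch := char_poly_spectral Uu WE.
have Deig i : eigenvalue W (D 0 i).
  rewrite eigenvalue_root_char ch.
  by rewrite (bigD1 i)//= rootM root_XsubC eqxx.
have eig1 : exists i, D 0 i = 1.
  have : eigenvalue W 1.
    apply/eigenvalueP; exists (const_mx 1).
      rewrite scale1r; apply/rowP => j; rewrite !mxE -[RHS](col1 j).
      by apply: eq_bigr => i _; rewrite mxE mul1r.
    apply/eqP => /rowP/(_ (Ordinal n2)).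
    by rewrite !mxE => /eqP; rewrite oner_eq0.
  rewrite eigenvalue_root_char ch.
  rewrite -(big_map (fun i => D 0 i) xpredT (fun a => 'X - a%:P)).
  by rewrite root_prod_XsubC => /mapP[i _ ->]; exists i.
have rowc i : D 0 i = 1 -> exists c, row i U = c *: const_mx 1.
  move=> Di; apply/sub_rVP.
  have -> : const_mx 1 = map_mx (real_complex R) (const_mx 1 : 'rV[R]_n).
    by apply/rowP => j; rewrite !mxE.
  have : (row i U <= map_mx (real_complex R) (eigenspace W 1))%MS.
    by rewrite map_eigenspace; apply/eigenspaceP; rewrite (row_spectral Uu WE) Di.
  by move/submx_trans; apply; rewrite map_submx averaging_eigenspace1.
have Uij i j : \sum_k U i k * (U j k)^* = (i == j)%:R.
  have /matrixP/(_ i j) := unitarymxP Uu; rewrite !mxE => <-.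
  by apply: eq_bigr => k _; rewrite !mxE.
have [i0 D0] := eig1.
(* Two orthonormal rows of [U] cannot both be multiples of [const_mx 1]. *)
have D1 j : j != i0 -> D 0 j != 1.
  move=> ji0; apply/eqP => Dj.
  have [c Uc] := rowc _ D0; have [c' Uc'] := rowc _ Dj.
  have Ec k : U i0 k = c by have /rowP/(_ k) := Uc; rewrite !mxE mulr1.
  have Ec' k : U j k = c' by have /rowP/(_ k) := Uc'; rewrite !mxE mulr1.
  have Es a b x y : (forall k, U a k = x) -> (forall k, U b k = y) ->
      n%:R * (x * y^*) = (a == b)%:R.
    move=> Ux Uy; rewrite -Uij; under eq_bigr do rewrite Ux Uy.
    by rewrite sumr_const card_ord mulr_natl.
  have /eqP := Es _ _ _ _ Ec Ec; have /eqP := Es _ _ _ _ Ec' Ec'.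
  have /eqP := Es _ _ _ _ Ec' Ec; rewrite !eqxx (negbTE ji0) !mulf_eq0 conjC_eq0.
  by case/or3P => /eqP -> ; rewrite ?(mul0r, mulr0) (eq_sym 0) oner_eq0.
case Es: (eigenvalues W) srt pm => [|s0 s].
  move=> _ /perm_size; rewrite size_map size_enum_ord => nE.
  by exfalso; move: n2; rewrite -nE.
move=> srt pm.
have s01 : s0 = 1.
  apply/eqP; rewrite eq_le; apply/andP; split.
    have : s0 \in s0 :: s by rewrite mem_head.
    rewrite (perm_mem pm) => /mapP[i _ ->].
    by case/andP: (averaging_eigenvalue_bounds (Deig i)).
  have : 1 \in s0 :: s.
    by rewrite (perm_mem pm) -D0; apply/mapP; exists i0; rewrite ?mem_enum.
  rewrite inE => /predU1P[->//|]; move: srt => /= /order_path_min.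
  by move=> /(_ (fun x y z xy yz => le_trans yz xy))/allP; apply.
(* Dropping the index [i0] matches dropping the head 1, so every entry of [s] is some [D 0 j] with
   [j != i0]. *)
have ps : perm_eq s [seq D 0 j | j <- rem i0 (enum 'I_n)].
  rewrite -(perm_cons 1) -{1}s01 (perm_trans pm)//.
  rewrite -D0 -[_ :: map _ _]/(map (fun j => D 0 j) (i0 :: _)).
  by apply: perm_map; apply: perm_to_rem; rewrite mem_enum.
exists s; split.
- by rewrite s01.
- have := perm_size pm; rewrite size_map size_enum_ord => <-//.
- move=> a; rewrite (perm_mem ps) => /mapP[j].
  rewrite mem_rem_uniq ?enum_uniq// inE.
  move=> /andP[/D1 Dj _] ->; have /andP[Dj1 Dj2] := averaging_eigenvalue_bounds (Deig j).
  by rewrite Dj1 lt_neqAle Dj2 andbT; exact: Dj.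
- move=> v v0.
  have Dle j : j != i0 -> D 0 j <= lambda 2 W.
    move=> ji0; have : D 0 j \in s.
      rewrite (perm_mem ps); apply: map_f.
      by rewrite mem_rem_uniq ?enum_uniq// inE ji0 mem_enum.
    rewrite /lambda Es /=; case: s srt {pm Es ps} => //= s1 s /andP[_ srt].
    rewrite inE => /predU1P[->//|]; move: srt => /order_path_min.
    by move=> /(_ (fun x y z xy yz => le_trans yz xy))/allP; apply.
  rewrite -lecR rmorphM /= (spectral_form WE) (spectral_norm Uu) mulr_sumr.
  apply: ler_sum => j _; have [->|/Dle Dj] := eqVneq j i0; last first.
    by rewrite ler_wpM2r ?exprn_ge0// lecR.
  (* The coordinate along row [i0] is a multiple of the sum of [v], so the eigenvalue 1 contributes
     nothing. *)
  suff -> : (map_mx (real_complex R) v *m U ^t*) 0 i0 = 0.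
    by rewrite normr0 expr0n !mulr0.
  have [c Uc] := rowc _ D0; rewrite mxE.
  transitivity ((\sum_j (v 0 j))%:C%C * c^*).
    rewrite rmorph_sum mulr_suml; apply: eq_bigr => k _; rewrite !mxE.
    by have /rowP/(_ k) := Uc; rewrite !mxE mulr1 => ->.
  by rewrite v0 mul0r.
Qed.

Lemma beta_averaging : (2 <= n)%N -> 0 <= beta W < 1.
Proof.
move=> n2; have [s [Es ss sb _]] := eigenvalues_averaging n2.
(* In this range the 1-based index skips the head 1 and stays inside [s], so the default value of
   [nth] is never read. *)
have lt1 k : (2 <= k <= n)%N -> `|lambda k W| < 1.
  case: k => [|[|k]]// kn; rewrite /lambda Es /= ltr_norml; apply: sb.
  by apply: mem_nth; rewrite ss; case: (n) kn.
rewrite /beta le_max normr_ge0/= gt_max.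
by apply/andP; split; apply: lt1; rewrite leqnn n2.
Qed.

Lemma averaging_gap (v : 'rV[R]_n) : (2 <= n)%N ->
  (1 - beta W) * \sum_i (v 0 i - n%:R^-1 * \sum_j v 0 j) ^+ 2 <=
  (v *m v^T) 0 0 - (v *m W *m v^T) 0 0.
Proof.
move=> n2; set m := n%:R^-1 * _; have [s [_ _ _ gap]] := eigenvalues_averaging n2.
pose u := v - const_mx m.
have uE i : u 0 i = v 0 i - m by rewrite !mxE.
have u0 : \sum_i u 0 i = 0.
  under eq_bigr do rewrite uE; rewrite sumrB sumr_const card_ord -mulr_natl.
  rewrite /m mulrA mulfV ?mul1r ?subrr// pnatr_eq0 -lt0n.
  exact: leq_trans n2.
have -> : \sum_i (v 0 i - m) ^+ 2 = (u *m u^T) 0 0.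
  by rewrite mxE; apply: eq_bigr => i _; rewrite -uE [_^T _ _]mxE expr2.
(* The Dirichlet form sees only differences of entries, so centring [v] at its mean leaves it
   unchanged. *)
have -> : (v *m v^T) 0 0 - (v *m W *m v^T) 0 0 =
          (u *m u^T) 0 0 - (u *m W *m u^T) 0 0.
  have N1 : (-1) ^+ 2 = 1 :> R by rewrite sqrrN expr1n.
  apply: (mulfI (_ : 2 != 0 :> R)); first by rewrite pnatr_eq0.
  rewrite -[- (v *m W *m _) 0 0]mulN1r -[- (u *m W *m _) 0 0]mulN1r.
  rewrite -!averaging_form//.
  by apply: eq_bigr => i _; apply: eq_bigr => j _; rewrite !uE; ring.
have uu0 : 0 <= (u *m u^T) 0 0.
  by rewrite mxE; apply: sumr_ge0 => i _; rewrite [_^T _ _]mxE -expr2 sqr_ge0.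
have lb : lambda 2 W <= beta W by rewrite /beta le_max ler_norm.
by have := gap _ u0; nra.
Qed.

End Averaging.

End Spectral.

(** * Gradient inequality for convex functions, and calculus on stacked vectors *)

Lemma convex_derive_le (R : realType) (V : normedModType R) (g : V -> R) (x w : V) :
  (forall t, 0 <= t <= 1 ->
     g (t *: (x + w) + (1 - t) *: x) <= t * g (x + w) + (1 - t) * g x) ->
  derivable g x w -> 'D_w g x <= g (x + w) - g x.
Proof.
move=> gconv dg.
(* Convexity bounds the difference quotient only for [0 < t <= 1], so the derivative is taken as a
   right-sided limit. *)
have dgr : (fun t => t^-1 *: ((g \o shift x) (t *: w) - g x)) @ 0^'+ --> 'D_w g x.
  apply: cvg_trans dg; apply: cvg_app.
  move=> A [e egt0 Ae]; exists e => // t te tgt0; apply: Ae => //.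
  exact/lt0r_neq0.
apply: (cvgr_to_le dgr).
near=> t.
have t0 : 0 < t by near: t; exact: nbhs_right_gt.
have t1 : t <= 1 by near: t; exact: nbhs_right_le.
rewrite /= ler_pdivrMl//.
have /gconv : 0 <= t <= 1 by rewrite (ltW t0).
have -> : t *: (x + w) + (1 - t) *: x = t *: w + x.
  by rewrite scalerDr addrAC -scalerDl addrCA subrr addr0 scale1r addrC.
by rewrite /shift /=; lra.
Unshelve. all: by end_near. Qed.

Section Blocks.
Variables (R : realType) (n d : nat).
Implicit Types x w : 'cV[R]_(n * d).

Lemma blockE x i k : block x i k 0 = x (mxtens_index (i, k)) 0.
Proof. by rewrite mxE. Qed.

Lemma blockD x w i : block (x + w) i = block x i + block w i.
Proof. by apply/colP => k; rewrite !mxE. Qed.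

Lemma blockZ a x i : block (a *: x) i = a *: block x i.
Proof. by apply/colP => k; rewrite !mxE. Qed.

Lemma block_sum m (F : 'I_m -> 'cV[R]_(n * d)) i :
  block (\sum_l F l) i = \sum_l block (F l) i.
Proof.
apply/colP => k; rewrite !(mxE, summxE); apply: eq_bigr => l _; by rewrite mxE.
Qed.

Lemma sum_tens (F : 'I_(n * d) -> R) :
  \sum_l F l = \sum_i \sum_k F (mxtens_index (i, k)).
Proof.
rewrite pair_bigA /= (reindex (@mxtens_index n d)) /=; last first.
  by exists (@mxtens_unindex n d) => ? _; rewrite ?mxtens_indexK ?mxtens_unindexK.
by apply: eq_bigr => -[i k].
Qed.

Lemma block_bigW (W : 'M[R]_n) x i :
  block (bigW d W *m x) i = \sum_j W i j *: block x j.
Proof.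
apply/colP => k; rewrite mxE mxE sum_tens summxE; apply: eq_bigr => j _.
rewrite !mxE (bigD1 k)//= big1 => [|l /negbTE lk].
  by rewrite tensmxE mxE eqxx mulr1 addr0.
by rewrite tensmxE mxE eq_sym lk mulr0 mul0r.
Qed.

Lemma derive_fsum_block (f : 'I_n -> 'cV[R]_d -> R) x w :
  (forall i, derivable (f i) (block x i) (block w i)) ->
  'D_w (fsum f) x = \sum_i 'D_(block w i) (f i) (block x i).
Proof.
move=> df.
(* Since [block] is linear, the difference quotients coincide and no chain rule is involved. *)
have E i : (fun t : R => t^-1 *: (((fun y => f i (block y i)) \o shift x) (t *: w) -
      f i (block x i))) =
   (fun t => t^-1 *: ((f i \o shift (block x i)) (t *: block w i) - f i (block x i))).
  by apply/funext => t; rewrite /= blockD blockZ.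
have -> : fsum f = \sum_i (fun y => f i (block y i)).
  by apply/funext => y; rewrite fct_sumE.
rewrite derive_sum; last by move=> i; rewrite /derivable E; exact: df.
by apply: eq_bigr => i _; rewrite /derive E.
Qed.

Lemma grad_fsum_dot (f : 'I_n -> 'cV[R]_d -> R) x w :
  (forall i y, differentiable (f i) y) ->
  \sum_l w l 0 * grad (fsum f) x l 0 = \sum_i 'd (f i) (block x i) (block w i).
Proof.
move=> df.
under eq_bigr => l _.
  rewrite mxE derive_fsum_block; last by move=> i; apply: diff_derivable.
  rewrite mulr_sumr.
  over.
rewrite exchange_big /=; apply: eq_bigr => i _.
have {2}-> : w = \sum_l w l 0 *: delta_mx l 0.
  by rewrite {1}[w]matrix_sum_delta; apply: eq_bigr => l _; rewrite big_ord1.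
rewrite block_sum linear_sum; apply: eq_bigr => l _ /=.
by rewrite blockZ linearZ deriveE.
Qed.

Lemma fsum_gradient_le (f : 'I_n -> 'cV[R]_d -> R) x w :
  (forall i, convex_efunction (fun y => (f i y)%:E)) ->
  (forall i y, differentiable (f i) y) ->
  \sum_l w l 0 * grad (fsum f) x l 0 <= fsum f (x + w) - fsum f x.
Proof.
move=> fconv df; rewrite grad_fsum_dot// /fsum -sumrB.
apply: ler_sum => i _; rewrite -deriveE// blockD.
apply: convex_derive_le; last exact: diff_derivable.
move=> t t01; have := fconv i t (block x i + block w i) (block x i) t01.
by rewrite -!EFinM -EFinD lee_fin.
Qed.

End Blocks.

(** * Variational inequality for the proximal map *)

Lemma enorm_sqr (R : realType) d (x : 'cV[R]_d) :
  enorm x ^+ 2 = \sum_j x j 0 ^+ 2.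
Proof. by rewrite sqr_sqrtr// sumr_ge0// => j _; exact: sqr_ge0. Qed.

(** The minimizer [x] is compared with points of the segment towards [y]; after division by [t] the
    quadratic remainder keeps a factor [t] and can be made negligible. *)
Lemma prox_variational (R : realType) m (g : 'cV[R]_m -> \bar R)
    (v x y : 'cV[R]_m) (a b : R) :
  prox g v x -> g x = a%:E ->
  (forall t, 0 <= t <= 1 ->
     (g (t *: y + (1 - t) *: x)%R <= (t * b + (1 - t) * a)%:E)%E) ->
  0 <= b - a + \sum_l (y - x) l 0 * (x - v) l 0.
Proof.
move=> px gx gseg; set S := \sum_l _.
have key t : 0 < t <= 1 -> 0 <= b - a + S + t * (2^-1 * enorm (y - x) ^+ 2).
  move=> /andP[t0 t1]; have t01 : 0 <= t <= 1 by rewrite ltW.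
  have := px (t *: y + (1 - t) *: x); rewrite gx -EFinD.
  move=> /le_trans/(_ (leeD2r _ (gseg t t01))); rewrite -EFinD lee_fin.
  have -> : enorm (t *: y + (1 - t) *: x - v) ^+ 2 =
      enorm (x - v) ^+ 2 + 2 * t * S + t ^+ 2 * enorm (y - x) ^+ 2.
    rewrite !enorm_sqr /S !mulr_sumr -!big_split /=; apply: eq_bigr => l _.
    by rewrite !mxE; ring.
  move=> le; rewrite -(pmulr_rge0 _ t0); nra.
rewrite leNgt; apply/negP => neg.
set N := 2^-1 * enorm (y - x) ^+ 2 in key.
have N0 : 0 <= N by rewrite mulr_ge0 ?invr_ge0 ?sqr_ge0.
set s := b - a + S in key neg.
have q0 : 0 < N + 1 - s by lra.
(* A step [t <= 1] small enough for [s + t * N] to stay negative. *)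
have /key : 0 < - s / (N + 1 - s) <= 1.
  by rewrite divr_gt0 ?oppr_gt0//= ler_pdivrMr// mul1r; lra.
apply/negP; rewrite -ltNge.
have -> : s + - s / (N + 1 - s) * N = s * (1 - s) / (N + 1 - s).
  by field; rewrite gt_eqF.
by rewrite pmulr_llt0 ?invr_gt0//; nra.
Qed.

Lemma fin_num_of_sum_lty (R : realType) (I : finType) (F : I -> \bar R) :
  (forall i, F i != -oo%E) -> (\sum_i F i < +oo)%E -> forall i, F i \is a fin_num.
Proof.
move=> Fny Foo i; rewrite fin_numE Fny /=; apply/eqP => Fi.
suff E : (\sum_i F i = +oo)%E by rewrite E ltxx in Foo.
by apply/esum_eqyP => //; exists i.
Qed.

(** The consensual vector in which every agent holds [z], used as test point in the optimality
    condition. *)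
Definition stack (R : realType) n d (z : 'cV[R]_d) : 'cV[R]_(n * d) :=
  \col_l z (mxtens_unindex l).2 0.

Lemma block_stack (R : realType) n d (z : 'cV[R]_d) (i : 'I_n) :
  block (stack n z) i = z.
Proof. by apply/colP => k; rewrite !mxE mxtens_indexK. Qed.

Lemma residual_block (R : realType) n d (W : 'M[R]_n) (x : 'cV[R]_(n * d)) i k :
  (x - bigW d W *m x) (mxtens_index (i, k)) 0 =
  block x i k 0 - \sum_j W i j * block x j k 0.
Proof.
rewrite -blockE blockD -scaleN1r blockZ block_bigW scaleN1r mxE; congr (_ + _).
by rewrite mxE summxE; congr (- _); apply: eq_bigr => j _; rewrite mxE.
Qed.

(** * Energy estimate at a fixed point of Prox-DGD *)

Section FixedPoint.
Variables (R : realType) (n d : nat) (e : rel 'I_n) (W : 'M[R]_n).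
Hypothesis We : averaging_matrix e W.

(** Columns of [W] sum to 1, so in each coordinate the residuals of all agents add up to 0, and a
    consensual vector weighs them equally. *)
Lemma residual_stack_orth (z : 'cV[R]_d) (x : 'cV[R]_(n * d)) :
  \sum_l stack n z l 0 * (x - bigW d W *m x) l 0 = 0.
Proof.
case: We => _ _ _ col1 _.
rewrite sum_tens exchange_big big1 // => k _ /=.
under eq_bigr do rewrite -blockE block_stack residual_block.
rewrite -mulr_sumr; apply/eqP; rewrite mulf_eq0; apply/orP; right; apply/eqP.
rewrite sumrB exchange_big /= -sumrB big1 // => j _.
by rewrite -mulr_suml col1 mul1r subrr.
Qed.

Lemma residual_energy_ge (x : 'cV[R]_(n * d)) : (2 <= n)%N -> connected_graph e ->
  (1 - beta W) * \sum_i enorm (block x i - mean x) ^+ 2 <=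
  \sum_l x l 0 * (x - bigW d W *m x) l 0.
Proof.
move=> n2 conn; case: (We) => Wsym _ _ _ _.
under eq_bigr do rewrite enorm_sqr.
rewrite exchange_big mulr_sumr sum_tens exchange_big /=.
(* [bigW] acts on each coordinate separately, so the gap inequality is applied to the [k]-th
   coordinates of all blocks and summed over [k]. *)
apply: ler_sum => k _; pose v := \row_i block x i k 0.
have := averaging_gap We conn v n2.
have -> : \sum_i (v 0 i - n%:R^-1 * \sum_j v 0 j) ^+ 2 =
    \sum_i (block x i - mean x) k 0 ^+ 2.
  apply: eq_bigr => i _; congr (_ ^+ 2).
  have subE (p q : 'cV[R]_d) : (p - q) k 0 = p k 0 - q k 0 by rewrite !mxE.
  rewrite subE [mean x _ _]mxE summxE [v _ _]mxE; congr (_ - _ * _).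
  by apply: eq_bigr => j _; rewrite mxE.
move=> /le_trans; apply; rewrite le_eqVlt; apply/orP; left; apply/eqP.
rewrite ![(_ *m v^T) _ _]mxE -sumrB; apply: eq_bigr => i _.
rewrite residual_block -blockE -mulrBl mulrC [v^T _ _]mxE ![v _ _]mxE.
congr (_ * (_ - _)); rewrite mxE; apply: eq_bigr => j _.
by rewrite [v _ _]mxE mulrC -[in LHS]Wsym [W^T _ _]mxE.
Qed.

Variables (f : 'I_n -> 'cV[R]_d -> R) (h : 'I_n -> 'cV[R]_d -> \bar R).
Hypothesis f_conv : forall i, convex_efunction (fun x => (f i x)%:E).
Hypothesis f_diff : forall i x, differentiable (f i) x.
Hypothesis h_ny : forall i x, h i x != -oo%E.
Hypothesis h_conv : forall i, convex_efunction (h i).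

(** The prox objective is finite at the consensual vector of [z], so its minimizer has finite
    [hsum]; as no term is -oo, every term is finite. *)
Lemma fixed_point_fin_num alpha x z : 0 < alpha ->
  proxDGD_fixed_point f h W alpha x -> (forall i, h i z \is a fin_num) ->
  forall i, h i (block x i) \is a fin_num.
Proof.
move=> a0 px zfin.
have zE : hsum h (stack n z) = (\sum_i fine (h i z))%:E.
  by rewrite /hsum -sumEFin; apply: eq_bigr => i _; rewrite block_stack fineK.
have := px (stack n z); rewrite zE -EFinM -EFinD => le.
apply: fin_num_of_sum_lty => //; rewrite ltey; apply/eqP => xoo.
move: le; rewrite /hsum xoo mulry gtr0_sg// mul1e.
by rewrite addye// leye_eq.
Qed.

(* The penalty term of [stack n z] vanishes, which is why testing the
   optimality condition there leaves only the energy of [x]. *)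
Lemma fixed_point_energy alpha x z : 0 < alpha ->
  proxDGD_fixed_point f h W alpha x -> (forall i, h i z \is a fin_num) ->
  alpha * (fsum f x + \sum_i fine (h i (block x i))) +
    \sum_l x l 0 * (x - bigW d W *m x) l 0 <=
  alpha * \sum_i (f i z + fine (h i z)).
Proof.
move=> a0 px zfin; have xfin := fixed_point_fin_num a0 px zfin.
set a := \sum_i fine (h i (block x i)); rewrite big_split /=.
set b := \sum_i fine (h i z).
have gx : (alpha%:E * hsum h x)%E = (alpha * a)%:E.
  rewrite EFinM /hsum -sumEFin; congr (_ * _)%E.
  by apply: eq_bigr => i _; rewrite fineK.
have := @prox_variational _ _ _ _ _ (stack n z) _ (alpha * b) px gx.
have seg t : 0 <= t <= 1 ->
    (alpha%:E * hsum h (t *: stack n z + (1 - t) *: x)%R <=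
     (t * (alpha * b) + (1 - t) * (alpha * a))%:E)%E.
  move=> t01; rewrite !(mulrCA _ alpha) -mulrDr EFinM lee_pmul2l//.
  rewrite !mulr_sumr -big_split /hsum -sumEFin /=; apply: lee_sum => i _.
  rewrite blockD !blockZ block_stack.
  apply: le_trans (h_conv i z (block x i) t01) _.
  by rewrite [leRHS]EFinD !EFinM !fineK.
move=> /(_ seg).
have := fsum_gradient_le x (stack n z - x) f_conv f_diff.
have -> : fsum f (x + (stack n z - x)) = \sum_i f i z.
  rewrite addrCA subrr addr0; apply: eq_bigr => i _; by rewrite block_stack.
have orth := residual_stack_orth z x.
(* The tested vector is the residual plus [alpha] times the gradient, so the pairing splits into a
   gradient term, a consensual term killed by [orth], and minus the energy of [x]. *)
have -> : \sum_l (stack n z - x) l 0 *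
      (x - (bigW d W *m x - alpha *: grad (fsum f) x)) l 0 =
    alpha * \sum_l (stack n z - x) l 0 * grad (fsum f) x l 0 +
    \sum_l stack n z l 0 * (x - bigW d W *m x) l 0 -
    \sum_l x l 0 * (x - bigW d W *m x) l 0.
  rewrite mulr_sumr -big_split -sumrB /=; apply: eq_bigr => l _.
  move: (bigW d W *m x) (grad _ x) (stack n z) => p q s.
  by rewrite !mxE; ring.
by rewrite orth; nra.
Qed.

End FixedPoint.

(** * Choice of the constant and the two final bounds *)

Unset Implicit Arguments.
Set Strict Implicit.

Theorem lemma1 (R : realType) (n d : nat) (n_ge2 : (2 <= n)%N)
    (f : 'I_n -> 'cV[R]_d -> R) (h : 'I_n -> 'cV[R]_d -> \bar R)
    (f_pcc : forall i, proper_closed_convex (fun x => (f i x)%:E))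
    (h_pcc : forall i, proper_closed_convex (h i))
    (f_smooth : forall i, exists L : R, 0 < L /\ smooth L (f i))
    (fh_bounded_below : forall i, exists m : R,
        forall x, (m%:E <= (f i x)%:E + h i x)%E)
    (optimal_nonempty : argmin (objective f h) !=set0)
    (Fopt_finite : Fopt f h \is a fin_num) :
  exists C : R, 0 <= C /\
    forall (e : rel 'I_n) (W : 'M[R]_n),
      connected_graph e ->
      averaging_matrix e W ->
      (forall alpha : R, 0 < alpha -> argmin (penalized f h W alpha) !=set0) ->
      0 <= beta W < 1 /\
      forall (alpha : R) (x : 'cV[R]_(n * d)),
        0 < alpha ->
        proxDGD_fixed_point f h W alpha x ->
        (Fsum f h x <= Fopt f h)%E /\
        forall i : 'I_n,
          enorm (block x i - mean x) <= C * Num.sqrt (alpha / (1 - beta W)).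
Proof.
have h_ny i x : h i x != -oo%E by have [[]] := h_pcc i.
have h_conv i : convex_efunction (h i) by have [] := h_pcc i.
have f_conv i : convex_efunction (fun x => (f i x)%:E) by have [] := f_pcc i.
have f_diff i x : differentiable (f i) x by have [L [_ []]] := f_smooth i.
have /choice[m fh_ge] := fh_bounded_below.
have [z zmin] := optimal_nonempty.
have objz : objective f h z = Fopt f h.
  apply/eqP; rewrite eq_le; apply/andP; split.
    by apply: le_ereal_inf_tmp => _ [y _ <-]; exact: zmin.
  by apply: ereal_inf_lbound; exists z.
have zfin i : h i z \is a fin_num.
  have zlt : (objective f h z < +oo)%E by rewrite objz ltey_eq Fopt_finite.
  have fh_ny j : ((f j z)%:E + h j z != -oo)%E.
    by rewrite adde_eq_ninfty negb_or h_ny.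
  have := fin_num_of_sum_lty fh_ny zlt i.
  by rewrite fin_numD => /andP[].
set Fz := \sum_i (f i z + fine (h i z)).
have objzE : objective f h z = Fz%:E.
  by rewrite /objective /Fz -sumEFin; apply: eq_bigr => i _; rewrite EFinD fineK.
(* Fixed before [e], [W] and [alpha]. The energy at a fixed point will be at most
   [alpha * (Fz - Fx)], where [Fx] is the value there and is at least [\sum_i m i]. *)
exists (Num.sqrt (Fz - \sum_i m i)); split; first exact: sqrtr_ge0.
move=> e W conn We _; have b01 := beta_averaging We conn n_ge2.
split=> // alpha x alpha_gt0 px; move: b01 => /andP[_ b1].
have xfin := fixed_point_fin_num h_ny alpha_gt0 px zfin.
have energy := fixed_point_energy We f_conv f_diff h_ny h_conv alpha_gt0 px zfin.
have gap := residual_energy_ge We x n_ge2 conn.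
set Fx := fsum f x + _ in energy; set E := \sum_l _ in energy gap.
rewrite -/Fz in energy; set S := \sum_i _ in gap.
have S0 : 0 <= S by apply: sumr_ge0 => i _; exact: sqr_ge0.
have FxE : Fsum f h x = Fx%:E.
  rewrite /Fsum /Fx EFinD; congr (_ + _)%E; rewrite -sumEFin.
  by apply: eq_bigr => i _; rewrite fineK.
have Fx_ge : \sum_i m i <= Fx.
  rewrite /Fx /fsum -big_split; apply: ler_sum => i _ /=.
  by rewrite -lee_fin EFinD fineK.
(* As [beta W < 1], [gap] makes [E] nonnegative, so [energy] leaves [alpha * Fx <= alpha * Fz]. *)
split=> [|i]; first by rewrite FxE -objz objzE lee_fin; nra.
(* The radicand [Fz - \sum_i m i] is nonnegative because [\sum_i m i <= Fx <= Fz]. After squaring,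
   the deviation of one block is a single summand of [S]. *)
rewrite -sqrtrM; last by nra.
rewrite -[leLHS]ger0_norm ?sqrtr_ge0// -sqrtr_sqr ler_wsqrtr// mulrA.
rewrite ler_pdivlMr ?subr_gt0//.
have Si : enorm (block x i - mean x) ^+ 2 <= S.
  by rewrite /S (bigD1 i)//= lerDl; apply: sumr_ge0 => j _; exact: sqr_ge0.
nra.
Qed.
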